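(* (Yoneda lemma) Let $\mathcal{C}$ be a non-associative category, let $A\in\operatorname{obj}(\mathcal{C})$, and let $G:\mathcal{C}\to\mathbf{Sets}$ be a covariant functor. Then the map $$y:\operatorname{Nat}(w\text{-}\operatorname{Hom}_{\mathcal{C}}(A,-),G)\to G(A),\qquad \tau\mapsto\tau_A(1_A)$$ is a bijection.
   Context: A non-associative category $\mathcal{C}$ consists of a class of objects, a set $\operatorname{Hom}_{\mathcal{C}}(X,Y)$ for every ordered pair of objects, and compositions $\operatorname{Hom}_{\mathcal{C}}(X,Y)\times\operatorname{Hom}_{\mathcal{C}}(Y,Z)\to\operatorname{Hom}_{\mathcal{C}}(X,Z)$, $(f,g)\mapsto gf$ (not required to be associative), such that each morphism has a unique domain and target and each object $X$ has an identity $1_X\in\operatorname{Hom}_{\mathcal{C}}(X,X)$ with $f1_X=f$, $1_Yf=f$ for all $f\in\operatorname{Hom}_{\mathcal{C}}(X,Y)$. A morphism $f$ is associative if every composable triple of morphisms in which $f$ occurs in any one of the three positions composes associatively: $(fg)h=f(gh)$, $(gf)h=g(fh)$, $(gh)f=g(hf)$ for all $g,h$ for which the composites make sense. A covariant functor $T:\mathcal{C}\to\mathcal{D}$ between non-associative categories assigns objects to objects and maps $\operatorname{Hom}_{\mathcal{C}}(X,X')\to\operatorname{Hom}_{\mathcal{D}}(T(X),T(X'))$ with $T(gf)=T(g)T(f)$ for all composable $f,g$ and $T(1_X)=1_{T(X)}$. A covariant weak functor is defined in the same way, except that $T(gf)=T(g)T(f)$ is required only if at least one of $f,g$ is an associative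 morphism. $\mathbf{Sets}$ is the usual category of sets. The weak Hom functor $w\text{-}\operatorname{Hom}_{\mathcal{C}}(A,-):\mathcal{C}\to\mathbf{Sets}$ is the covariant weak functor sending $C$ to $\operatorname{Hom}_{\mathcal{C}}(A,C)$ and $f:C\to C'$ to the map $h\mapsto fh$. For covariant weak functors $F,G:\mathcal{C}\to\mathcal{D}$, a natural transformation $\tau:F\to G$ is a family of morphisms $\tau_X:F(X)\to G(X)$ with $\tau_YF(f)=G(f)\tau_X$ for every morphism $f:X\to Y$ of $\mathcal{C}$; $\operatorname{Nat}(F,G)$ denotes the collection of all such. *)

(* Defs.v *)
From mathcomp Require Import ssreflect ssrfun ssrbool.
From Stdlib Require Import FunctionalExtensionality.

Set Implicit Arguments.
Unset Strict Implicit.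
Unset Printing Implicit Defensive.

Declare Scope nacat_scope.
Delimit Scope nacat_scope with nacat.

(* Objects may live in a larger universe than hom-sets.  Hom-sets are indexed
   by their endpoints, so every morphism has a unique domain and target. *)
Record naCategory := NaCategory {
  obj :> Type;
  hom : obj -> obj -> Type;
  comp : forall {X Y Z : obj}, hom Y Z -> hom X Y -> hom X Z;
  idm : forall X : obj, hom X X;
  comp_idr : forall (X Y : obj) (f : hom X Y), comp f (idm X) = f;
  comp_idl : forall (X Y : obj) (f : hom X Y), comp (idm Y) f = f
}.

Arguments hom {n} X Y.
Arguments comp {n X Y Z} g f.
Arguments idm {n} X.
Arguments comp_idr {n X Y} f.
Arguments comp_idl {n X Y} f.

(* [g \oc f] is the composite written gf: first f, then g. *)
Notation "g \oc f" := (comp g f) (at level 50, left associativity) : nacat_scope.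
Local Open Scope nacat_scope.

Definition associative_mor (C : naCategory) (X Y : C) (f : hom X Y) : Prop :=
  [/\ forall (V W : C) (g : hom W X) (h : hom V W),
        (f \oc g) \oc h = f \oc (g \oc h),
      forall (W Z : C) (g : hom Y Z) (h : hom W X),
        (g \oc f) \oc h = g \oc (f \oc h)
    & forall (Z V : C) (g : hom Z V) (h : hom Y Z),
        (g \oc h) \oc f = g \oc (h \oc f)].

Record functor (C D : naCategory) := Functor {
  fun_obj :> C -> D;
  fun_map : forall X Y : C, hom X Y -> hom (fun_obj X) (fun_obj Y);
  fun_comp : forall (X Y Z : C) (f : hom X Y) (g : hom Y Z),
    fun_map (g \oc f) = fun_map g \oc fun_map f;
  fun_id : forall X : C, fun_map (idm X) = idm (fun_obj X)
}.

Record weak_functor (C D : naCategory) := WeakFunctor {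
  wfun_obj :> C -> D;
  wfun_map : forall X Y : C, hom X Y -> hom (wfun_obj X) (wfun_obj Y);
  wfun_comp : forall (X Y Z : C) (f : hom X Y) (g : hom Y Z),
    associative_mor f \/ associative_mor g ->
    wfun_map (g \oc f) = wfun_map g \oc wfun_map f;
  wfun_id : forall X : C, wfun_map (idm X) = idm (wfun_obj X)
}.

Arguments fun_map {C D} f {X Y} _ : rename.
Arguments wfun_map {C D} w {X Y} _ : rename.

Definition weak_of_functor (C D : naCategory) (T : functor C D) :
    weak_functor C D :=
  @WeakFunctor C D (fun_obj T) (@fun_map C D T)
    (fun X Y Z f g _ => fun_comp T f g) (fun_id T).

Coercion weak_of_functor : functor >-> weak_functor.

Record nat_trans (C D : naCategory) (F G : weak_functor C D) := NatTrans {
  nt_mor :> forall X : C, hom (F X) (G X);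
  nt_natural : forall (X Y : C) (f : hom X Y),
    nt_mor Y \oc wfun_map F f = wfun_map G f \oc nt_mor X
}.

Definition Sets : naCategory :=
  @NaCategory Type (fun X Y => X -> Y)
    (fun X Y Z g f x => g (f x)) (fun X x => x)
    (fun X Y f => erefl f) (fun X Y f => erefl f).

Section WeakHom.
Variables (C : naCategory) (A : C).

Definition wHom_map (X Y : C) (f : hom X Y) : hom A X -> hom A Y :=
  fun h => f \oc h.

Lemma wHom_comp (X Y Z : C) (f : hom X Y) (g : hom Y Z) :
  associative_mor f \/ associative_mor g ->
  wHom_map (g \oc f) = fun h => wHom_map g (wHom_map f h).
Proof.
by move=> fg; apply: functional_extensionality => h; case: fg => -[H1 H2 H3];
  [exact: H2 | exact: H1].
Qed.

Lemma wHom_id (X : C) : wHom_map (idm X) = fun h => h.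
Proof. by apply: functional_extensionality => h; exact: comp_idl. Qed.

Definition wHom : weak_functor C Sets :=
  @WeakFunctor C Sets (fun X => hom A X) wHom_map wHom_comp wHom_id.

End WeakHom.

Definition yoneda_map (C : naCategory) (A : C) (G : functor C Sets)
    (tau : nat_trans (wHom A) G) : G A :=
  tau A (idm A).

Arguments yoneda_map {C} A G tau.

(* Main.v *)
Require Import Defs.
From mathcomp Require Import ssreflect ssrfun ssrbool.
From Stdlib Require Import FunctionalExtensionality ProofIrrelevance.

(** Every [h : hom A X] is the composite [h \oc idm A], so naturality along
    [h], evaluated at [idm A], forces [tau X h = G h (tau A (idm A))]: a natural
    transformation out of [wHom A] is determined by its value at [idm A]
    ([nat_trans_wHomE]).  Conversely, for every [x : G A] the family
    [h |-> G h x] is natural ([yoneda_inv]), and its value at [idm A] is [x].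

    Associativity of composition in [C] never enters: naturality of
    [h |-> G h x] along [f] says [G (f \oc h) x = G f (G h x)], which is exactly
    preservation of composition by [G], and this is where it matters that [G]
    is a functor and not merely a weak one. *)

Set Implicit Arguments.
Unset Strict Implicit.
Unset Printing Implicit Defensive.

Local Open Scope nacat_scope.

(** The naturality proofs are compared by proof irrelevance, since the
    hom-sets of the target may fail to have unique identity proofs. *)
Lemma nat_trans_ext (C D : naCategory) (F G : weak_functor C D)
    (s t : nat_trans F G) :
  (forall X : C, s X = t X) -> s = t.
Proof.
case: s t => [s sN] [t tN] /= st.
have {}st : s = t by apply: functional_extensionality_dep.
by case: t / st tN => tN; rewrite (proof_irrelevance _ sN tN).
Qed.

Lemma nat_trans_wHomE (C : naCategory) (A : C) (G : weak_functor C Sets)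
    (tau : nat_trans (wHom A) G) (X : C) (h : hom A X) :
  tau X h = wfun_map G h (tau A (idm A)).
Proof.
have /= /(congr1 (fun k => k (idm A))) := nt_natural tau h.
by rewrite /wHom_map comp_idr.
Qed.

Section YonedaInverse.
Variables (C : naCategory) (A : C) (G : functor C Sets).

Lemma yoneda_inv_natural (x : G A) (X Y : C) (f : hom X Y) :
  (fun h : hom A X => fun_map G (f \oc h) x) =
  (fun h : hom A X => fun_map G f (fun_map G h x)).
Proof. by apply: functional_extensionality => h; rewrite fun_comp. Qed.

Definition yoneda_inv (x : G A) : nat_trans (wHom A) G :=
  @NatTrans C Sets (wHom A) G (fun X h => fun_map G h x)
    (yoneda_inv_natural x).

Lemma yoneda_mapK : cancel (@yoneda_map C A G) yoneda_inv.
Proof.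
move=> tau; apply: nat_trans_ext => X.
by apply: functional_extensionality => h; exact: esym (nat_trans_wHomE tau h).
Qed.

Lemma yoneda_invK : cancel yoneda_inv (@yoneda_map C A G).
Proof. by move=> x; rewrite /yoneda_map /= fun_id. Qed.

End YonedaInverse.

Theorem theorem4p13 (C : naCategory) (A : C) (G : functor C Sets) :
  bijective (yoneda_map A G).
Proof. exact: Bijective (@yoneda_mapK C A G) (@yoneda_invK C A G). Qed.
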